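(* Let $A=\{x_1,x_2\}$ be an alphabet of two variables. For every positive integer $n$, $$\sum_{k=0}^{n}\binom{n}{k}(x_1-x_2)^{n-k}(n-k-1)\left(2^k\phi_k(x_1+x_2)-2(x_1+x_2)^k\right)B_{n-k}=n(1-n)(x_1-x_2)^2(x_1+x_2)^{n-2},$$ $$\sum_{k=0}^{n}\binom{n}{k}(x_1-x_2)^{n-k}(2^{n-k}-1)(n-k-1)\left(2^k\phi_k(x_1+x_2)+2(x_1+x_2)^k\right)B_{n-k}=-n(1-n)(x_1-x_2)^2(x_1+x_2)^{n-2}.$$
   Context: Here $x_1,x_2$ are two commuting variables (indeterminates) and identities are in the field of rational functions in them. The notation $\phi_n(x_1+x_2)$ denotes the function of the alphabet $\{x_1,x_2\}$ (not of the sum) given by $\phi_n(x_1+x_2)=x_1^n+x_2^n$ for $n\ge 0$; the expression $(x_1+x_2)^k$ is the ordinary power of the sum. The Bernoulli numbers $B_n$ are defined by $\sum_{n\ge 0}B_n\frac{z^n}{n!}=\frac{z}{e^z-1}$ (so $B_1=-\tfrac12$). *)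

(* Defs.v *)
From HB Require Import structures.
From mathcomp Require Import all_boot all_order all_algebra.
From mathcomp Require Export mpoly.

Set Implicit Arguments.
Unset Strict Implicit.
Unset Printing Implicit Defensive.

Import Order.TTheory GRing.Theory Num.Theory.
Local Open Scope ring_scope.

(* Formal power series over rat are represented by their coefficient
   sequences; the product is the Cauchy product. *)
Definition fps := nat -> rat.

Definition fps_mul (f g : fps) : fps :=
  fun n => \sum_(k < n.+1) f k * g (n - k)%N.

Definition fps_X : fps := fun n => (n == 1)%:R.

Definition fps_expm1 : fps := fun n => if n == 0%N then 0 else (n`!%:R)^-1.

Definition egf (a : nat -> rat) : fps := fun n => a n / n`!%:R.

(* sum_n B_n z^n / n! = z / (e^z - 1), with the denominator cleared: the ring
   of power series has no zero divisors, so this is the meaning of the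
   quotient. *)
Definition is_bernoulli (B : nat -> rat) : Prop :=
  fps_mul (egf B) fps_expm1 =1 fps_X.

Fixpoint bernoulli_coefs (n : nat) : seq rat :=
  if n is m.+1 then
    let s := bernoulli_coefs m in
    rcons s ((m == 0%N)%:R - \sum_(k < m) s`_k / (m - k).+1`!%:R)
  else [::].

Lemma size_bernoulli_coefs n : size (bernoulli_coefs n) = n.
Proof. by elim: n => //= n IH; rewrite size_rcons IH. Qed.

Lemma nth_bernoulli_coefs n k :
  (k < n)%N -> (bernoulli_coefs n)`_k = (bernoulli_coefs k.+1)`_k.
Proof.
elim: n => // n IH; rewrite ltnS leq_eqVlt => /predU1P[-> //|kn].
by rewrite [LHS]/= nth_rcons size_bernoulli_coefs kn IH.
Qed.

Lemma fps_mul_expm1S (f : fps) n :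
  fps_mul f fps_expm1 n.+1 = f n + \sum_(k < n) f k / (n - k).+1`!%:R.
Proof.
rewrite /fps_mul big_ord_recr /= subnn mulr0 addr0.
rewrite big_ord_recr /= subSnn /fps_expm1 /= invr1 mulr1 addrC; congr (_ + _).
by apply: eq_bigr => k _; rewrite subSn // ltnW.
Qed.

Lemma fps_mul_expm10 (f : fps) : fps_mul f fps_expm1 0 = 0.
Proof. by rewrite /fps_mul big_ord1 mulr0. Qed.

Lemma bernoulli_exists : {B : nat -> rat | is_bernoulli B}.
Proof.
pose c n := (bernoulli_coefs n.+1)`_n.
have cE n : c n = (n == 0%N)%:R - \sum_(k < n) c k / (n - k).+1`!%:R.
  rewrite {1}/c /= nth_rcons size_bernoulli_coefs ltnn eqxx.
  by congr (_ - _); apply: eq_bigr => k _; rewrite nth_bernoulli_coefs.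
exists (fun n => c n * n`!%:R) => n.
have fact0 m : m`!%:R != 0 :> rat by rewrite pnatr_eq0 -lt0n fact_gt0.
case: n => [|n]; first by rewrite fps_mul_expm10.
rewrite fps_mul_expm1S {1}/egf mulfK // cE.
under [X in _ - _ + X]eq_bigr => k _ do rewrite /egf mulfK //.
by rewrite subrK /fps_X eqSS.
Qed.

Lemma is_bernoulli_unique B C : is_bernoulli B -> is_bernoulli C -> B =1 C.
Proof.
move=> hB hC n; elim/ltn_ind: n => n IH.
have fact0 m : m`!%:R != 0 :> rat by rewrite pnatr_eq0 -lt0n fact_gt0.
have := hB n.+1; rewrite -(hC n.+1) !fps_mul_expm1S.
under eq_bigr => k _ do rewrite /egf IH //.
by move/addIr; rewrite /egf => /divIf; apply.
Qed.

Definition bernoulli : nat -> rat := sval bernoulli_exists.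

Lemma bernoulliP : is_bernoulli bernoulli.
Proof. exact: (svalP bernoulli_exists). Qed.

Lemma bernoulli1 : bernoulli 1 = - 2%:R^-1.
Proof.
have := bernoulliP 1; have := bernoulliP 2.
rewrite !fps_mul_expm1S !big_ord1 big_ord0 /fps_X /egf /= !divr1 addr0 => + b0.
by rewrite b0 mul1r => /eqP; rewrite addr_eq0 => /eqP.
Qed.

Definition ratfun2 : fieldType := {fraction {mpoly rat[2]}}.

Definition constf (c : rat) : ratfun2 := tofrac (c%:MP_[2]).

Definition x1 : ratfun2 := tofrac ('X_(@ord0 1)).
Definition x2 : ratfun2 := tofrac ('X_(@ord_max 1)).

Definition phi (n : nat) (y1 y2 : ratfun2) : ratfun2 := y1 ^+ n + y2 ^+ n.

(* Main.v *)
Require Import Defs.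
From mathcomp Require Import all_boot all_order all_algebra.
From mathcomp Require Import ring.

Import GRing.Theory Num.Theory.
Local Open Scope ring_scope.

(** For a sequence [a] put [A_n(x) = \sum_k 'C(n, k) a_(n-k) x^k].  Re-expanding
at a shifted point, [A_n(x + d) = \sum_k 'C(n, k) A_(n-k)(d) x^k], so a relation
between [A_n(d)] and [a_n] propagates to one between [A_n(x + d)] and [A_n(x)].
For [a_m = B_m d^m] this is [A_n(x + d) - A_n(x) = n d x^(n-1)], and for
[a_m = (2^m - 1) B_m d^m] it is [A_n(x + d) + A_n(x) = - n d x^(n-1)].  The
weight [m - 1] turns [A_n(x)] into [(n - 1) A_n(x) - n x A_(n-1)(x)].  With
[s = x1 + x2] and [d = x1 - x2] one has [2 x1 = s + d] and [2 x2 = s - d], so the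
two sums are second differences (respectively sums) at [s] of the weighted
polynomials. *)

Section Appell.
Variable R : comNzRingType.
Implicit Types (a b : nat -> R) (x y d : R).

Definition appell a n x : R := \sum_(k < n.+1) 'C(n, k)%:R * a (n - k)%N * x ^+ k.

Lemma eq_appell a b n x : a =1 b -> appell a n x = appell b n x.
Proof. by move=> ab; apply: eq_bigr => k _; rewrite ab. Qed.

Lemma appell0 a x : appell a 0 x = a 0%N.
Proof. by rewrite /appell big_ord1 bin0 expr0 mulr1 mul1r. Qed.

(** Pascal's rule: each step raises either the power of [x] or the index of [a]. *)
Lemma appellS a n x :
  appell a n.+1 x = x * appell a n x + appell (a \o succn) n x.
Proof.
rewrite [LHS]big_ord_recl /= bin0 subn0 expr0.
under eq_bigr => k _ do rewrite /bump /= add1n binS natrD subSS 2!mulrDl.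
rewrite big_split /= big_ord_recr /= bin_small // !mul0r addr0.
rewrite [in RHS]addrC [appell _ _ x]big_ord_recl /= bin0 subn0 expr0.
rewrite mulr_sumr -!addrA; congr (_ + (_ + _)); apply: eq_bigr => k _.
  by rewrite /bump /= add1n subnSK.
by rewrite exprS; ring.
Qed.

Lemma appellD a b n x : appell (fun m => a m + b m) n x = appell a n x + appell b n x.
Proof. by rewrite -big_split /=; apply: eq_bigr => k _; ring. Qed.

Lemma appellZ (c : R) a n x : appell (fun m => c * a m) n x = c * appell a n x.
Proof. by rewrite mulr_sumr; apply: eq_bigr => k _; ring. Qed.

(** Since [appellS] changes the sequence, the induction runs over all [a]; expanding the values at
    [y] by the same recursion produces the factor [x + y]. *)
Lemma appell_shift a n x y : appell a n (x + y) = appell (appell a ^~ y) n x.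
Proof.
elim: n a => [|n IH] a; first by rewrite !appell0.
rewrite !appellS !IH.
have -> : appell (appell a ^~ y \o succn) n x
        = appell (fun m => y * appell a m y + appell (a \o succn) m y) n x.
  by apply: eq_appell => m /=; rewrite appellS.
by rewrite appellD appellZ mulrDl addrA.
Qed.

Lemma appell_delta0 n x : appell (fun m => (m == 0%N)%:R) n x = x ^+ n.
Proof.
rewrite /appell big_ord_recr /= subnn binn big1 => [|k _]; first by rewrite add0r !mul1r.
by rewrite subn_eq0 leqNgt ltn_ord mulr0 mul0r.
Qed.

Lemma appell_delta1 n x : appell (fun m => (m == 1)%:R) n x = n%:R * x ^+ n.-1.
Proof.
elim: n => [|n IH]; first by rewrite appell0 mul0r.
rewrite appellS IH (_ : appell (_ \o _) n x = x ^+ n) ?appell_delta0 //=.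
by case: n {IH} => [|n] /=; rewrite ?exprS; ring.
Qed.

Lemma appell_scale a n x y :
  appell (fun m => a m * y ^+ m) n (x * y) = appell a n x * y ^+ n.
Proof.
rewrite mulr_suml; apply: eq_bigr => k _.
have -> : y ^+ n = y ^+ (n - k) * y ^+ k by rewrite -exprD subnK -1?ltnS.
by rewrite exprMn; ring.
Qed.

(** Coefficientwise this is (n + 1 - k) C(n + 1, k) = (n + 1) C(n, k). *)
Lemma appell_natmul a n x :
  appell (fun m => m%:R * a m) n.+1 x = n.+1%:R * appell (a \o succn) n x.
Proof.
have S_natmul b m y : appell ((fun m => m%:R * b m) \o succn) m y =
    appell (fun m => m%:R * (b \o succn) m) m y + appell (b \o succn) m y.
  by rewrite -appellD; apply: eq_appell => k /=; rewrite -natr1; ring.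
elim: n a => [|n IH] a; first by rewrite appellS S_natmul !appell0; ring.
rewrite appellS S_natmul !IH (appellS (a \o succn)) -[n.+2%:R]natr1.
by ring.
Qed.

Lemma appell_natpred a n x :
  appell (fun m => (m%:R - 1) * a m) n x
  = (n%:R - 1) * appell a n x - n%:R * x * appell a n.-1 x.
Proof.
have -> : appell (fun m => (m%:R - 1) * a m) n x
        = appell (fun m => m%:R * a m) n x - appell a n x.
  by rewrite -[- appell _ _ _]mulN1r -appellZ -appellD; apply: eq_appell => m; ring.
case: n => [|n]; first by rewrite !appell0; ring.
rewrite appell_natmul (_ : appell (a \o succn) n x =
  appell a n.+1 x - x * appell a n x); last by rewrite appellS; ring.
by rewrite /=; ring.
Qed.

(** The hypothesis at [s] and at [s - d] reduces everything to values at [s]. These cancel because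
    (s + d) + (s - d) = 2s, and so do the powers of [s - d]. *)
Lemma second_difference_natpred a n s d :
    (forall m x, appell a m (x + d) = appell a m x + m%:R * d * x ^+ m.-1) ->
  let b m := (m%:R - 1) * a m in
  appell b n (s + d) + appell b n (s - d) - 2 * appell b n s
  = n%:R * (1 - n%:R) * d ^+ 2 * s ^+ n.-2.
Proof.
move=> aD; rewrite /= !appell_natpred !aD.
have aB m : appell a m (s - d) = appell a m s - m%:R * d * (s - d) ^+ m.-1.
  by have := aD m (s - d); rewrite subrK => ->; ring.
(* For n < 2 the exponent [n.-2] is truncated, but n (1 - n) vanishes. *)
rewrite !aB; case: n => [|[|n]] /=; first by ring.
  by rewrite !expr0; ring.
by rewrite !exprS -[n.+2%:R]natr1 -[n.+1%:R]natr1; ring.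
Qed.

Lemma second_sum_natpred a n s d :
    (forall m x, appell a m (x + d) = - appell a m x - m%:R * d * x ^+ m.-1) ->
  let b m := (m%:R - 1) * a m in
  appell b n (s + d) + appell b n (s - d) + 2 * appell b n s
  = - (n%:R * (1 - n%:R) * d ^+ 2 * s ^+ n.-2).
Proof.
move=> aD; rewrite /= !appell_natpred !aD.
have aB m : appell a m (s - d) = - appell a m s - m%:R * d * (s - d) ^+ m.-1.
  by have := aD m (s - d); rewrite subrK => ->; ring.
rewrite !aB; case: n => [|[|n]] /=; first by ring.
  have := aD 0%N 0; rewrite !appell0 => /eqP; rewrite -subr_eq0 => /eqP h.
  by rewrite !expr0; ring: h.
by rewrite !exprS -[n.+2%:R]natr1 -[n.+1%:R]natr1; ring.
Qed.

End Appell.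

Arguments appell {R}.
Arguments eq_appell {R} [a] b [n x].
Arguments second_difference_natpred {R} [a] n s [d].
Arguments second_sum_natpred {R} [a] n s [d].

Lemma appell_rmorph (R S : comNzRingType) (f : {rmorphism R -> S}) (a : nat -> R) n x :
  appell (f \o a) n (f x) = f (appell a n x).
Proof.
rewrite rmorph_sum; apply: eq_bigr => k _.
by rewrite !rmorphM rmorph_nat rmorphXn.
Qed.

(* Cancellation of [e^z - 1] for exponential generating functions. *)
Lemma appell1_fixed_eq0 (c : nat -> rat) :
  (forall n, appell c n 1 = c n) -> forall n, c n = 0.
Proof.
move=> cE; elim/ltn_ind => n IH.
(* At n + 1 the terms c_(n+1) cancel and the induction hypothesis kills all others except (n + 1)
   c_n. *)
have := cE n.+1; rewrite /appell big_ord_recl big_ord_recl big1 => [|k _].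
  rewrite bin0 bin1 subn0 subSS subn0 !expr1n !mulr1 mul1r addr0.
  by move=> /(canRL (addKr _))/eqP; rewrite addNr mulf_eq0 pnatr_eq0 => /eqP.
by rewrite !lift0 subSS IH ?mulr0 ?mul0r // subnSK ?leq_subr.
Qed.

(** With B(z) = z / (e^z - 1), these are the coefficients of B(z) e^z = B(z) + z. *)
Lemma bernoulli_appell1 n : appell bernoulli n 1 = bernoulli n + (n == 1)%:R.
Proof.
have fact0 m : m`!%:R != 0 :> rat by rewrite pnatr_eq0 -lt0n fact_gt0.
have <- : n`!%:R * fps_mul (egf bernoulli) fps_expm1 n = (n == 1)%:R.
  by rewrite bernoulliP /fps_X; case: eqP => [->|]; rewrite ?mulr1 ?mulr0.
rewrite /appell (reindex_inj rev_ord_inj) big_ord_recr /fps_mul big_ord_recr /=.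
rewrite !subSS !subnn subn0 bin0 expr0 mul1r !mulr1 mulr0 addr0 addrC.
congr (_ + _); rewrite mulr_sumr; apply: eq_bigr => k _.
rewrite subSS subKn 1?ltnW // bin_sub 1?ltnW // expr1n mulr1 /egf /fps_expm1.
rewrite subn_eq0 leqNgt ltn_ord /= -(bin_fact (ltnW (ltn_ord k))) !natrM.
by field; rewrite !fact0.
Qed.

(** Minus half the Genocchi numbers: the exponential generating function is E(z) = B(2z) - B(z) = -
    z / (e^z + 1). *)
Definition euler_const n : rat := (2 ^+ n - 1) * bernoulli n.

Lemma euler_const_appell1 n :
  appell euler_const n 1 = - euler_const n - (n == 1)%:R.
Proof.
pose delta (m : nat) : rat := (m == 1)%:R.
have B1 m : appell bernoulli m 1 = bernoulli m + delta m.
  exact: bernoulli_appell1.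
have B2 m : appell bernoulli m (1 + 1) = bernoulli m + delta m + m%:R.
  rewrite appell_shift (eq_appell _ B1) appellD B1.
  by rewrite appell_delta1 expr1n mulr1.
have E2 m : appell euler_const m (1 + 1) = euler_const m + delta m - m%:R.
  rewrite (eq_appell (fun m => bernoulli m * 2 ^+ m + -1 * bernoulli m));
    last by move=> k; rewrite /euler_const; ring.
  have := appell_scale _ bernoulli m 1 2; rewrite mul1r appellD appellZ B2 => ->.
  rewrite B1 /euler_const /delta; case: eqP => [->|_] /=; ring.
(* The generating function of [c] is E(z) (e^z + 1) + z. Its product with e^z - 1 is zero, because
   [E2] says E(z) (e^(2z) - 1) = z - z e^z. *)
pose c m := appell euler_const m 1 + (euler_const m + delta m).
suff : c n = 0 by move/eqP; rewrite addr_eq0 opprD => /eqP.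
apply: appell1_fixed_eq0 => m; rewrite /c !appellD -appell_shift E2.
by rewrite appell_delta1 expr1n /delta; ring.
Qed.

Section Homogeneous.
Variables (R : comNzRingType) (f : {rmorphism rat -> R}) (d : R).

(** By [appell_shift] only the values at [d] matter, and homogeneity turns them into [d ^+ m] times
    the image under [f] of a rational identity at 1. *)
Lemma bernoulli_appellD n x :
  let a m := f (bernoulli m) * d ^+ m in
  appell a n (x + d) = appell a n x + n%:R * d * x ^+ n.-1.
Proof.
move=> a; rewrite appell_shift.
rewrite (eq_appell (fun m => a m + d * (m == 1)%:R)) => [|m].
  by rewrite appellD appellZ appell_delta1; ring.
rewrite -[d in LHS]mul1r -(rmorph1 f) appell_scale appell_rmorph.
rewrite bernoulli_appell1 rmorphD rmorph_nat mulrDl /a.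
by case: eqP => [->|_] /=; ring.
Qed.

Lemma euler_const_appellD n x :
  let a m := f (euler_const m) * d ^+ m in
  appell a n (x + d) = - appell a n x - n%:R * d * x ^+ n.-1.
Proof.
move=> a; rewrite appell_shift.
rewrite (eq_appell (fun m => -1 * a m + - d * (m == 1)%:R)) => [|m].
  by rewrite appellD !appellZ appell_delta1; ring.
rewrite -[d in LHS]mul1r -(rmorph1 f) appell_scale appell_rmorph.
rewrite euler_const_appell1 rmorphB rmorphN rmorph_nat mulrBl /a.
by case: eqP => [->|_] /=; ring.
Qed.

End Homogeneous.

Theorem theorem7 (n : nat) (n_gt0 : (0 < n)%N) :
  (\sum_(0 <= k < n.+1)
      'C(n, k)%:R * (x1 - x2) ^+ (n - k) * ((n - k)%:R - 1)
      * (2 ^+ k * phi k x1 x2 - 2 * (x1 + x2) ^+ k)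
      * constf (bernoulli (n - k))
   = n%:R * (1 - n%:R) * (x1 - x2) ^+ 2 * (x1 + x2) ^ (n%:Z - 2))
  /\
  (\sum_(0 <= k < n.+1)
      'C(n, k)%:R * (x1 - x2) ^+ (n - k) * (2 ^+ (n - k) - 1) * ((n - k)%:R - 1)
      * (2 ^+ k * phi k x1 x2 + 2 * (x1 + x2) ^+ k)
      * constf (bernoulli (n - k))
   = - (n%:R * (1 - n%:R) * (x1 - x2) ^+ 2 * (x1 + x2) ^ (n%:Z - 2))).
Proof.
(* This is [constf], packaged as a ring morphism. *)
pose f : {rmorphism rat -> ratfun2} := @tofrac {mpoly rat[2]} \o @mpolyC 2 rat.
set s := x1 + x2; set d := x1 - x2.
have phiE k : 2 ^+ k * phi k x1 x2 = (s + d) ^+ k + (s - d) ^+ k.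
  rewrite /phi mulrDr -!exprMn; congr (_ ^+ k + _ ^+ k); rewrite /s /d; ring.
(* For [n = 1] the exponent [n - 2] is negative, but the factor [1 - n] is zero. *)
have -> : n%:R * (1 - n%:R) * d ^+ 2 * s ^ (n%:Z - 2)
        = n%:R * (1 - n%:R) * d ^+ 2 * s ^+ n.-2.
  case: n n_gt0 => [//|[|n]] _; first by rewrite subrr mulr0 !mul0r.
  by rewrite (_ : n.+2%:Z - 2 = n) // -addn2 PoszD addrK.
split.
  rewrite -(second_difference_natpred n s (bernoulli_appellD _ f d)).
  rewrite big_mkord /appell mulr_sumr -big_split -sumrB; apply: eq_bigr => k _.
  by rewrite phiE -[constf _]/(f _) /=; ring.
rewrite -(second_sum_natpred n s (euler_const_appellD _ f d)).
rewrite big_mkord /appell mulr_sumr -!big_split; apply: eq_bigr => k _.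
rewrite phiE -[constf _]/(f _) /euler_const rmorphM rmorphB rmorphXn rmorph1.
by rewrite rmorph_nat /=; ring.
Qed.
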